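(* If $G$ is a finite cubic graph on $n$ vertices that has a DET:OLD set, then $\mathrm{DET{:}OLD\%}(G) = \mathrm{DET{:}OLD}(G)/n \le \frac{30}{31}$.
   Context: For a graph $G$ and $v\in V(G)$, $N(v)$ is the open neighborhood of $v$. For $S\subseteq V(G)$ write $N_S(v)=N(v)\cap S$. A set $S\subseteq V(G)$ is a DET:OLD set of $G$ if (1) every vertex $v$ satisfies $|N_S(v)|\ge 2$, and (2) every pair of distinct vertices $u,v$ satisfies $|N_S(u)\setminus N_S(v)|\ge 2$ or $|N_S(v)\setminus N_S(u)|\ge 2$. $\mathrm{DET{:}OLD}(G)$ is the minimum cardinality of a DET:OLD set of $G$. A cubic graph is a 3-regular simple graph. *)

(* Defs.v *)
From mathcomp Require Import all_boot all_order all_algebra.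
Set Implicit Arguments.
Unset Strict Implicit.
Unset Printing Implicit Defensive.

Definition simple_graph (T : finType) (e : rel T) : Prop :=
  symmetric e /\ irreflexive e.

Definition open_nbhd (T : finType) (e : rel T) (v : T) : {set T} :=
  [set u | e v u].

Definition nbhd_in (T : finType) (e : rel T) (S : {set T}) (v : T) : {set T} :=
  open_nbhd e v :&: S.

Definition cubic (T : finType) (e : rel T) : Prop :=
  simple_graph e /\ forall v : T, #|open_nbhd e v| = 3.

Definition det_old (T : finType) (e : rel T) (S : {set T}) : bool :=
  [forall v, 2 <= #|nbhd_in e S v|] &&
  [forall u, forall v, (u != v) ==>
     ((2 <= #|nbhd_in e S u :\: nbhd_in e S v|)
   || (2 <= #|nbhd_in e S v :\: nbhd_in e S u|))].

(* The default #|T| bounds the size of every vertex set, so this is the true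
   minimum as soon as some DET:OLD set exists (see DET_OLD_minimum); it is
   meaningless for graphs without a DET:OLD set. *)
Definition DET_OLD (T : finType) (e : rel T) : nat :=
  \big[minn/#|T|]_(S : {set T} | det_old e S) #|S|.

Definition DET_OLD_pct (T : finType) (e : rel T) : rat :=
  ((DET_OLD e)%:R / #|T|%:R)%R.

Lemma DET_OLD_minimum (T : finType) (e : rel T) :
  (exists S : {set T}, det_old e S) ->
  (exists2 S : {set T}, det_old e S & #|S| = DET_OLD e) /\
  (forall S : {set T}, det_old e S -> DET_OLD e <= #|S|).
Proof.
case=> S0 S0P.
have lb (S : {set T}) : det_old e S -> DET_OLD e <= #|S|.
  move=> SP; rewrite /DET_OLD; have := mem_index_enum S.
  elim: (index_enum _) => //= S' r IHr; rewrite inE big_cons.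
  by case/predU1P=> [<-|/IHr le_r]; rewrite ?SP ?geq_minl //;
     case: ifP => _ //; rewrite geq_min le_r orbT.
split=> //.
case: (arg_minnP (fun S : {set T} => #|S|) S0P) => S SP Smin.
exists S => //; apply/eqP; rewrite eqn_leq lb // andbT.
rewrite /DET_OLD; elim/big_ind: _ => [|x y Sx Sy|S' /Smin //].
  exact: max_card.
by rewrite leq_min Sx Sy.
Qed.

(* Main.v *)
(** If some DET:OLD set exists, then two distinct vertices share at most one
    neighbour. Under this condition the complement of [R] is a DET:OLD set as
    soon as no two distinct vertices of [R] are the ends of a non-backtracking
    walk of length 2 or 4. In a cubic graph a vertex starts at most [3 * 2 = 6]
    such walks of length 2 and [3 * 2 * 2 * 2 = 24] of length 4, so a maximal
    such [R] satisfies [n <= (1 + 6 + 24) * #|R|]. *)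

Require Import Defs.
From mathcomp Require Import all_boot all_order all_algebra.
From mathcomp Require Import zify.

Set Implicit Arguments.
Unset Strict Implicit.
Unset Printing Implicit Defensive.

Import GRing.Theory Num.Theory.

Lemma card_bigcup_leq (I T : finType) (A : {set I}) (F : I -> {set T}) (m k : nat) :
  #|A| <= m -> (forall i, i \in A -> #|F i| <= k) ->
  #|\bigcup_(i in A) F i| <= m * k.
Proof.
move=> leAm leFk; apply: (@leq_trans (\sum_(i in A) #|F i|)).
  elim/big_rec2: _ => [|i B s _ leBs]; first by rewrite cards0.
  by rewrite (leq_trans (leq_card_setU _ _).1) // leq_add2l.
apply: (@leq_trans (\sum_(i in A) k)); first exact: leq_sum.
by rewrite sum_nat_const leq_mul2r leAm orbT.
Qed.

(** Take [R] inclusion-maximal. Every vertex then lies in [R] or conflicts with a member of [R], so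
    the closed [c]-neighbourhoods of [R], each of size at most [k.+1], cover [T]. *)
Lemma independent_set_lower_bound (T : finType) (c : rel T) (k : nat) :
  symmetric c -> (forall a, #|[set b | c a b]| <= k) ->
  exists2 R : {set T},
    {in R &, forall a b, a != b -> ~~ c a b} & #|T| <= #|R| * k.+1.
Proof.
move=> symc lek.
pose indep (R : {set T}) :=
  [forall a in R, forall b in R, (a != b) ==> ~~ c a b].
have indepP (R : {set T}) : reflect {in R &, forall a b, a != b -> ~~ c a b} (indep R).
  apply: (iffP forall_inP) => [indR a b Ra Rb | indR a Ra].
    by move/(_ a Ra)/forall_inP/(_ b Rb)/implyP: indR.
  by apply/forall_inP => b Rb; apply/implyP/indR.
have indep0 : indep set0 by apply/indepP => a b; rewrite inE.
have [R /maxsetP[/indepP indR maxR] _] := maxset_exists indep0.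
exists R => //; rewrite -cardsT.
apply: leq_trans (@card_bigcup_leq _ _ R (fun a => a |: [set b | c a b]) _ _
                    (leqnn _) _); last first.
  move=> a _; apply: leq_trans (leq_card_setU _ _).1 _.
  by rewrite cards1 add1n ltnS.
apply/subset_leq_card/subsetP => x _; apply/bigcupP.
have [Rx | R'x] := boolP (x \in R); first by exists x; rewrite // setU11.
have [/exists_inP[a Ra cax] | /exists_inPn noc] :=
    boolP [exists a in R, c a x].
  by exists a; rewrite // !inE cax orbT.
(* An uncovered [x] could be added to [R], against maximality. *)
case/negP: R'x; rewrite -(maxR (x |: R)) ?setU11 ?subsetUr //.
apply/indepP => a b /setU1P[-> | Ra] /setU1P[-> | Rb].
- by rewrite eqxx.
- by rewrite symc => _; apply: noc.
- by move=> _; apply: noc.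
- exact: indR.
Qed.

(* Covers [n = 0], where the left-hand ratio is the junk value [0]. *)
Lemma ler_nat_ratio (F : numFieldType) (m n p q : nat) :
  0 < q -> q * m <= p * n -> (m%:R / n%:R <= p%:R / q%:R :> F)%R.
Proof.
move=> q0 le; have [-> | n0] := posnP n.
  by rewrite invr0 mulr0 divr_ge0 ?ler0n.
rewrite ler_pdivrMr ?ltr0n // mulrAC ler_pdivlMr ?ltr0n //.
by rewrite -!natrM ler_nat mulnC.
Qed.

Section Walks.

Variables (T : finType) (e : rel T).
Local Notation N := (open_nbhd e).

Definition walk2_ends (a : T) : {set T} := \bigcup_(u in N a) (N u :\ a).

Definition walk4_ends (a : T) : {set T} :=
  \bigcup_(u in N a) \bigcup_(w in N u :\ a) \bigcup_(v in N w :\ u) (N v :\ w).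

(** A 4-cycle through [a] gives [conflict a a]. This is harmless, since independence constrains only
    distinct vertices. *)
Definition conflict : rel T :=
  [rel a b | (b \in walk2_ends a) || (b \in walk4_ends a)].

Lemma walk2_endsP a b :
  reflect (exists u, [/\ e a u, e u b & a != b]) (b \in walk2_ends a).
Proof.
apply: (iffP bigcupP) => [[u] | [u [au ub neab]]].
  by rewrite !inE eq_sym => au /andP[neab ub]; exists u.
by exists u; rewrite !inE // ub eq_sym neab.
Qed.

Lemma walk4_endsP a b :
  reflect (exists u w v,
             [/\ e a u, e u w, e w v & e v b] /\ [/\ a != w, u != v & w != b])
          (b \in walk4_ends a).
Proof.
apply: (iffP bigcupP) => [[u] | [u [w [v [[au uw wv vb] [neaw neuv newb]]]]]].
  rewrite inE => au /bigcupP[w /setD1P[newa]]; rewrite inE => uw.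
  case/bigcupP=> v /setD1P[nevu]; rewrite inE => wv /setD1P[nebw].
  rewrite inE => vb; exists u, w, v.
  by rewrite (eq_sym a) (eq_sym u) (eq_sym _ b).
exists u; first by rewrite inE.
apply/bigcupP; exists w; first by rewrite !inE uw eq_sym neaw.
apply/bigcupP; exists v; first by rewrite !inE wv eq_sym neuv.
by rewrite !inE vb eq_sym newb.
Qed.

Lemma conflict_sym : symmetric e -> symmetric conflict.
Proof.
move=> syme; suff imp a b : conflict a b -> conflict b a.
  by move=> a b; apply/idP/idP => /imp.
case/orP=> [/walk2_endsP | /walk4_endsP].
  case=> u [au ub neab]; apply/orP; left; apply/walk2_endsP.
  by exists u; rewrite syme ub syme au eq_sym neab.
case=> u [w [v [[au uw wv vb] [neaw neuv newb]]]].
apply/orP; right; apply/walk4_endsP; exists v, w, u.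
by rewrite (syme b v) (syme v w) (syme w u) (syme u a) (eq_sym b)
   (eq_sym v) (eq_sym _ a).
Qed.

Lemma card_conflict (a : T) :
  cubic e -> #|[set b | conflict a b]| <= 30.
Proof.
case=> -[syme _] card3.
have card2 u w : e u w -> #|N u :\ w| <= 2.
  by move=> uw; have := cardsD1 w (N u); rewrite card3 inE uw; lia.
have -> : [set b | conflict a b] = walk2_ends a :|: walk4_ends a.
  by apply/setP => b; rewrite !inE.
apply: leq_trans (leq_card_setU _ _).1 _; rewrite -[30]/(3 * 2 + 3 * (2 * (2 * 2))).
apply: leq_add; apply: card_bigcup_leq => [|u]; rewrite ?card3 // inE => au.
  by apply: card2; rewrite syme.
apply: card_bigcup_leq => [|w]; first by apply: card2; rewrite syme.
case/setD1P=> _; rewrite inE => uw.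
apply: card_bigcup_leq => [|v]; first by apply: card2; rewrite syme.
by case/setD1P=> _; rewrite inE => wv; apply: card2; rewrite syme.
Qed.

(** Intersecting with [S] only shrinks the differences, so one of the two has size at least 2. As
    all neighbourhoods have size 3, both differences have the same size. *)
Lemma det_old_card_nbhdD (S : {set T}) (u v : T) :
  cubic e -> det_old e S -> u != v -> 2 <= #|N u :\: N v|.
Proof.
move=> [_ card3] /andP[_ /forallP/(_ u)/forallP/(_ v)/implyP sepS] /sepS.
have le x y : #|nbhd_in e S x :\: nbhd_in e S y| <= #|N x :\: N y|.
  apply/subset_leq_card/subsetP => z; rewrite !inE.
  by case: (z \in S); rewrite ?andbF ?andbT.
have := cardsID (N v) (N u); have := cardsID (N u) (N v).
rewrite !card3 setIC => Dvu Duv.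
by have [leuv levu] := (le u v, le v u); lia.
Qed.

Lemma det_old_setC (R : {set T}) :
  cubic e -> (forall u v, u != v -> 2 <= #|N u :\: N v|) ->
  {in R &, forall a b, a != b -> ~~ conflict a b} ->
  det_old e (~: R).
Proof.
case=> -[syme _] card3 sep indR.
(* Two members of [R] adjacent to [v] would end a walk of length 2 through [v], so [v] loses at most
   one of its three neighbours. *)
have dom v : 2 <= #|nbhd_in e (~: R) v|.
  rewrite /nbhd_in -setDE; have := cardsID R (N v); rewrite card3.
  suff: #|N v :&: R| <= 1 by lia.
  apply/card_le1_eqP => a b /setIP[]; rewrite inE => va Ra.
  case/setIP; rewrite inE => vb Rb; apply/eqP/contraT => neba.
  case/orP: (indR b a Rb Ra neba); left; apply/walk2_endsP.
  by exists v; rewrite syme.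
(* If [R] misses [N u :\: N v], the whole difference survives in the complement and [sep]
   applies. *)
have meets u v : u != v ->
    ~~ (2 <= #|nbhd_in e (~: R) u :\: nbhd_in e (~: R) v|) ->
    exists a, [/\ e u a, ~~ e v a & a \in R].
  move=> neuv; have [sub | ] := boolP (N u :\: N v \subset ~: R).
    rewrite (leq_trans (sep u v neuv)) //; apply/subset_leq_card/subsetP => a.
    move=> Da; move/subsetP/(_ a Da): sub; move: Da.
    by rewrite !inE => /andP[/negPf-> ->] ->.
  by case/subsetPn=> a; rewrite !inE negbK => /andP[va ua] Ra _; exists a.
rewrite /det_old; apply/andP; split; first exact/forallP.
apply/forallP=> u; apply/forallP=> v; apply/implyP=> neuv.
apply/contraT; rewrite negb_or => /andP[ltu ltv].
have [a [ua va Ra]] := meets u v neuv ltu.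
have [b [vb ub Rb]] : exists b, [/\ e v b, ~~ e u b & b \in R].
  by apply: meets; rewrite // eq_sym.
(* With no common neighbour outside [R], the difference at [u] would be its full restricted
   neighbourhood, which has size at least 2 by [dom]. *)
have [/eqP I0 | /set0Pn[w]] :=
    boolP (nbhd_in e (~: R) u :&: nbhd_in e (~: R) v == set0).
  have := cardsID (nbhd_in e (~: R) v) (nbhd_in e (~: R) u).
  by move: ltu (dom u); rewrite I0 cards0; lia.
rewrite !inE => /andP[/andP[uw _] /andP[vw _]].
have neab : a != b by apply: contraNneq va => ->.
(* The walk [a], [u], [w], [v], [b] does not backtrack: [w] is adjacent to both [u] and [v], whereas
   [a] is not adjacent to [v], nor [b] to [u]. *)
case/orP: (indR a b Ra Rb neab); right; apply/walk4_endsP; exists u, w, v.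
split; first by rewrite (syme a) (syme w).
split=> //; first by apply: contraNneq va => ->.
by apply: contraNneq ub => <-.
Qed.

End Walks.

Theorem theorem12 (T : finType) (e : rel T) :
  cubic e ->
  (exists S : {set T}, det_old e S) ->
  (DET_OLD_pct e <= 30%:R / 31%:R)%R.
Proof.
move=> cub exS; have [_ minS] := DET_OLD_minimum exS.
have [S detS] := exS.
have [R indR leTR] := independent_set_lower_bound (conflict_sym cub.1.1)
                        (fun a => card_conflict a cub).
(* The complement of [R] has [#|T| - #|R|] vertices, and [#|T| <= 31 * #|R|]. *)
have le31 : 31 * DET_OLD e <= 30 * #|T|.
  have detR : det_old e (~: R).
    by apply: det_old_setC => // u v; apply: det_old_card_nbhdD detS.
  by have := minS _ detR; have := cardsC R; lia.
exact: ler_nat_ratio.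
Qed.
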